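(* Let $(\mathcal H_0\oplus\mathcal H_1,\mathcal G,\gamma_0)$ be a first order boundary triple for the exterior derivative $d$. Then the (abstract) Green's formula holds: for all $f_0\in\mathcal H_0^1$ and $g_1\in\mathcal H_1^1$, $$\langle df_0,g_1\rangle_{\mathcal H_1}-\langle f_0,\delta g_1\rangle_{\mathcal H_0}=\langle\gamma_0f_0,\gamma_1g_1\rangle_{\mathcal G^{1/2}}=(\gamma_0f_0,\widetilde\gamma_1g_1)_{\mathcal G},$$ where $\widetilde\gamma_1:=\Lambda\gamma_1:\mathcal H_1^1\to\mathcal G^{-1/2}$.
   Context: Inner products are antilinear in the first and linear in the second argument. A first order boundary triple consists of Hilbert spaces $\mathcal H_0,\mathcal H_1,\mathcal G$, a closed linear operator $d$ from $\mathcal H_0$ to $\mathcal H_1$ (the exterior derivative) with dense domain $\mathcal H_0^1:=\operatorname{dom} d\subset\mathcal H_0$, normed by $\|f_0\|_{\mathcal H_0^1}^2=\|f_0\|^2+\|df_0\|^2$, and a bounded operator $\gamma_0:\mathcal H_0^1\to\mathcal G$ (boundary map) with dense range $\mathcal G^{1/2}:=\gamma_0(\mathcal H_0^1)\subset\mathcal G$ such that $\mathring{\mathcal H}_0^1:=\ker\gamma_0$ is dense in $\mathcal H_0$. Put $d_0:=d\restriction_{\mathring{\mathcal H}_0^1}$, $\delta:=d_0^*$ (the divergence operator, from $\mathcal H_1$ to $\mathcal H_0$), $\mathcal H_1^1:=\operatorname{dom}\delta$ with $\|f_1\|_{\mathcal H_1^1}^2=\|f_1\|^2+\|\delta f_1\|^2$.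 Let $\mathcal N_0:=\ker(\delta d+1)\subset\{f_0\in\operatorname{dom}d\mid df_0\in\operatorname{dom}\delta\}$ and $\mathcal N_1:=\ker(d\delta+1)\subset\{f_1\in\operatorname{dom}\delta\mid\delta f_1\in\operatorname{dom}d\}$, regarded as subspaces of $\mathcal H_0^1$, $\mathcal H_1^1$. The restriction $\hat\gamma_0:=\gamma_0\restriction_{\mathcal N_0}$ is a bijection onto $\mathcal G^{1/2}$, and $\mathcal G^{1/2}$ carries the Hilbert norm $\|\varphi\|_{\mathcal G^{1/2}}:=\|(\hat\gamma_0)^{-1}\varphi\|_{\mathcal H_0^1}$. The boundary map of order $1$ is $\gamma_1:=-\gamma_0\,\delta P_1:\mathcal H_1^1\to\mathcal G$, where $P_1$ is the orthogonal projection in $\mathcal H_1^1$ onto $\mathcal N_1$; it has range $\mathcal G^{1/2}$. $\Lambda:=(\gamma_0\gamma_0^* )^{-1}$ is a (possibly unbounded) positive self-adjoint operator in $\mathcal G$, where $\gamma_0^*:\mathcal G\to\mathcal H_0^1$ is the Hilbert space adjoint of $\gamma_0:\mathcal H_0^1\to\mathcal G$. For $s\ge0$, $\mathcal G^s:=\operatorname{dom}\Lambda^s$ with $\|\varphi\|_{\mathcal G^s}=\|\Lambda^s\varphi\|_{\mathcal G}$ (consistent with the definition of $\mathcal G^{1/2}$ above), and $\mathcal G^{-s}$ is the dual of $\mathcal G^s$ with respect to the pairing $(\cdot,\cdot)_{\mathcal G}$ extending the inner product of $\mathcal G$; $\Lambda$ extends to a unitary map $\mathcal G^{1/2}\to\mathcal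 G^{-1/2}$. *)

(* Defs.v *)
From HB Require Import structures.
From mathcomp Require Import all_boot all_order all_algebra sesquilinear.
From mathcomp Require Import complex.
From mathcomp Require Import all_classical all_reals all_analysis.
Import Order.TTheory GRing.Theory Num.Theory.

Set Implicit Arguments.
Unset Strict Implicit.
Unset Printing Implicit Defensive.

Local Open Scope classical_set_scope.
Local Open Scope ring_scope.

HB.mixin Record NormedModule_isHilbert (R : realType) (V : Type)
    of CompleteNormedModule (complex R) V := {
  hdot : {dot V for (@Num.conj (complex R))};
  hdot_norm : forall x : V, hdot x x = `|x| ^+ 2
}.

#[short(type="hilbertType")]
HB.structure Definition Hilbert (R : realType) :=
  {V of CompleteNormedModule (complex R) V & NormedModule_isHilbert R V}.

(* [{dot _ for _}] is linear in the first and antilinear in the second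
   argument; [inner] has the opposite (physicists') convention. *)
Definition inner (R : realType) (V : hilbertType R) (x y : V) : complex R :=
  hdot y x.

(* A partially defined operator; [app] is only meaningful on [dom]. *)
Record operator (V W : Type) := Operator { dom : set V; app :> V -> W }.

Section Operators.
Context {R : realType}.
Local Notation C := (complex R).

Definition linear_on (V W : lmodType C) (D : set V) (f : V -> W) :=
  forall a : C, {in D &, forall x y, f (a *: x + y) = a *: f x + f y}.

Definition linear_operator (V W : lmodType C) (T : operator V W) :=
  submod_closed (mem (dom T)) /\ linear_on (dom T) T.

Definition graph (V W : Type) (T : operator V W) : set (V * W) :=
  [set p | dom T p.1 /\ p.2 = T p.1].

Definition closed_operator (V W : hilbertType R) (T : operator V W) :=
  closed (graph T).

Definition restrict (V W : Type) (T : operator V W) (D : set V) :=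
  Operator (dom T `&` D) T.

Definition adjoint (V W : hilbertType R) (T : operator V W) : operator W V :=
  let is_adj y z := forall x, dom T x -> inner y (T x) = inner z x in
  Operator [set y | exists z, is_adj y z]
           (fun y => xget 0 [set z | is_adj y z]).

(* [kerD1 S T] is the kernel of S T + 1 on its natural domain. *)
Definition kerD1 (V W : lmodType C) (S : operator W V) (T : operator V W)
  : set V := [set x | [/\ dom T x, dom S (T x) & S (T x) + x = 0]].

Definition graph_inner (V W : hilbertType R) (T : operator V W) (x y : V) : C :=
  inner x y + inner (T x) (T y).

Definition graph_norm (V W : hilbertType R) (T : operator V W) (x : V) : C :=
  sqrtC (`|x| ^+ 2 + `|T x| ^+ 2).

(* The orthogonal projection, with respect to the graph inner product of [T],
   of an element [x] of [dom T] onto the subspace [N] of [dom T]. *)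
Definition graph_proj (V W : hilbertType R) (T : operator V W) (N : set V)
  (x : V) : V :=
  xget 0 [set p | N p /\ forall q, N q -> graph_inner T q (x - p) = 0].

End Operators.

Section BoundaryTriple.
Context {R : realType} {H0 H1 G : hilbertType R}.
Local Notation C := (complex R).
Variables (d : operator H0 H1) (gamma0 : H0 -> G).

Definition ker_gamma0 : set H0 := [set f | dom d f /\ gamma0 f = 0].

(* The boundary map is a total function; only its values on [dom d] matter. *)
Record boundary_triple : Prop := BoundaryTriple {
  ext_deriv_linear : linear_operator d;
  ext_deriv_closed : closed_operator d;
  ext_deriv_dense : dense (dom d);
  gamma0_linear : linear_on (dom d) gamma0;
  gamma0_bounded :
    exists M : C, forall f, dom d f -> `|gamma0 f| <= M * graph_norm d f;
  gamma0_dense_range : dense (gamma0 @` dom d);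
  gamma0_dense_kernel : dense ker_gamma0
}.

Definition divergence : operator H1 H0 := adjoint (restrict d ker_gamma0).

Definition N0 : set H0 := kerD1 divergence d.
Definition N1 : set H1 := kerD1 d divergence.

Definition Ghalf : set G := gamma0 @` dom d.

Definition hat_gamma0_inv (phi : G) : H0 :=
  xget 0 [set h | N0 h /\ gamma0 h = phi].

Definition Ghalf_inner (phi psi : G) : C :=
  graph_inner d (hat_gamma0_inv phi) (hat_gamma0_inv psi).

Definition Ghalf_norm (phi : G) : C := graph_norm d (hat_gamma0_inv phi).

Definition gamma1 (g : H1) : G :=
  - gamma0 (divergence (graph_proj divergence N1 g)).

(* The adjoint of [gamma0] as a bounded operator on [dom d] with the graph
   inner product (not on H0). *)
Definition gamma0_adj (eta : G) : H0 :=
  xget 0 [set h | dom d h /\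
    forall f, dom d f -> graph_inner d h f = inner eta (gamma0 f)].

Definition Lambda : operator G G :=
  Operator (range (gamma0 \o gamma0_adj))
           (fun phi => xget 0 [set eta | gamma0 (gamma0_adj eta) = phi]).

(* Elements of the dual of G^{1/2} are represented by antilinear functionals,
   of which only the values on G^{1/2} matter; the embedding of G sends [eta]
   to [inner ^~ eta]. *)
Definition pairing (phi : G) (F : G -> C) : C := F phi.

(* The norm of [F] in G^{-1/2} is at most [M]. *)
Definition Gmhalf_norm_le (F : G -> C) (M : C) :=
  forall phi, Ghalf phi -> `|pairing phi F| <= M * Ghalf_norm phi.

Definition Gmhalf : set (G -> C) := [set F |
  (forall a : C, {in Ghalf &, forall phi psi,
     F (a *: phi + psi) = Num.conj a * F phi + F psi}) /\
  exists M : C, Gmhalf_norm_le F M].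

(* Bounded linear maps G^{1/2} -> G^{-1/2} that agree with Lambda on its domain.
   As [dom Lambda] is dense in G^{1/2}, there is only one, up to values outside
   G^{1/2}: the unitary extension of Lambda. *)
Definition bounded_extension (L : G -> G -> C) :=
  [/\ forall psi, Ghalf psi -> Gmhalf (L psi),
      forall a : C, {in Ghalf & &, forall psi psi' phi,
        pairing phi (L (a *: psi + psi'))
        = a * pairing phi (L psi) + pairing phi (L psi')},
      exists M : C, forall psi, Ghalf psi ->
        Gmhalf_norm_le (L psi) (M * Ghalf_norm psi)
    & forall psi phi, dom Lambda psi -> Ghalf phi ->
        pairing phi (L psi) = inner phi (Lambda psi)].

Definition Lambda_ext : G -> G -> C :=
  xget (fun _ _ => 0) [set L | bounded_extension L].

Definition tilde_gamma1 (g : H1) : G -> C := Lambda_ext (gamma1 g).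

End BoundaryTriple.

(* Main.v *)
Require Import Defs.
From mathcomp Require Import all_boot all_order all_algebra sesquilinear.
From mathcomp Require Import complex all_classical all_reals all_analysis.
From mathcomp Require Import ring.
Import Order.TTheory GRing.Theory Num.Theory.
Import numFieldNormedType.Exports.

Set Implicit Arguments.
Unset Strict Implicit.
Unset Printing Implicit Defensive.

Local Open Scope classical_set_scope.
Local Open Scope ring_scope.

(** Everything takes place in [dom d] with the graph inner product, a Hilbert
    space because [d] is closed.  Since [gamma0] is bounded, [K = ker gamma0] is
    a closed subspace of it, and the definition of the divergence as the
    adjoint of [d] restricted to [K] says exactly that the orthogonal complement
    of [K] is [N0] ([N0_ortho], [ortho_N0]).  Hence every [f] in [dom d] is
    [u + k] with [u] in [N0] and [k] in [K] ([N0_decomposition]); [u] is the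
    preimage of [gamma0 f] under the bijection of [N0] onto [G^{1/2}], and the
    inner product of [G^{1/2}] becomes the graph inner product as soon as one of
    the two arguments comes from [N0] ([Ghalf_inner_gamma0]).

    First equality.  For [g] in the domain of the divergence, the functional
    [f |-> <df, g> - <f, div g>] is bounded in the graph norm and vanishes on
    [K], by definition of the divergence.  By Riesz representation it is
    [f |-> <f, h>] for some [h] in [N0].  The operators [d] and [- div] are
    mutually inverse bijections between [N0] and [N1], and under them the
    condition that [p = d h'] is the orthogonal projection of [g] onto [N1]
    reads [<w, h> = <w, h'>] for all [w] in [N0].  So the projection is [d h],
    and [gamma1 g = - gamma0 (div (d h)) = gamma0 h]
    ([gamma1_representative]); Green's formula is the defining property of [h].

    Second equality.  It says that the extension of [Lambda] to [G^{1/2}] is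
    the Riesz map of [G^{1/2}].  The Riesz map is a bounded extension of
    [Lambda] because [<phi, Lambda psi>] is the [G^{1/2}] inner product of [phi]
    and [psi] ([inner_Lambda]).  Conversely, let [L] be any bounded extension.
    For fixed [phi], Riesz representation turns [f |-> (phi, L (gamma0 f))] into
    an element [r] of [N0], and the difference of [r] and the preimage of [phi]
    in [N0] is orthogonal to the range of the adjoint of [gamma0], hence lies in
    [N0] and in [ker gamma0], hence is zero ([bounded_extensionE]).

    Riesz representation for the graph inner product ([riesz]) is proved by
    the Dirichlet principle, in a form that serves both [d] and its restriction
    to [K]. *)

(** * Inner products *)

Section Inner.
Context {R : realType} {V : hilbertType R}.
Implicit Types (x y z : V) (a : complex R).

Lemma innerC x y : inner y x = (inner x y)^*.
Proof. by rewrite /inner hermC /= expr0 mul1r. Qed.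

Lemma inner_norm x : inner x x = `|x| ^+ 2.
Proof. exact: hdot_norm. Qed.

Lemma innerPr z a x y : inner z (a *: x + y) = a * inner z x + inner z y.
Proof. by rewrite /inner linearPl. Qed.

Lemma innerPl z a x y : inner (a *: x + y) z = a^* * inner x z + inner y z.
Proof. by rewrite innerC innerPr rmorphD rmorphM /= -!innerC. Qed.

Lemma inner0r x : inner x 0 = 0.
Proof. by rewrite /inner linear0l. Qed.

Lemma innerNl x y : inner (- x) y = - inner x y.
Proof. by rewrite /inner linearNr. Qed.

Lemma innerDr x y z : inner x (y + z) = inner x y + inner x z.
Proof. by rewrite /inner linearDl. Qed.

Lemma innerBr x y z : inner x (y - z) = inner x y - inner x z.
Proof. by rewrite /inner linearBl. Qed.

Lemma innerBl x y z : inner (y - z) x = inner y x - inner z x.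
Proof. by rewrite /inner linearBr. Qed.

(** Expand the squared norm of [|x|^2 y - <x, y> x], a multiple of the component
    of [y] orthogonal to [x]. *)
Lemma cauchy_schwarz x y : `|inner x y| <= `|x| * `|y|.
Proof.
have [->|x0] := eqVneq x 0.
  by rewrite innerC inner0r conjC0 !normr0 mul0r.
have nx : 0 < `|x| ^+ 2 by rewrite exprn_gt0 ?normr_gt0.
rewrite -ler_sqr ?nnegrE ?mulr_ge0 // exprMn -subr_ge0 -(pmulr_rge0 _ nx).
suff <- : `|(`|x| ^+ 2) *: y - inner x y *: x| ^+ 2
    = `|x| ^+ 2 * (`|x| ^+ 2 * `|y| ^+ 2 - `|inner x y| ^+ 2).
  exact: exprn_ge0.
rewrite -(inner_norm (_ - _)) innerBr !innerBl.
rewrite -[_ *: y]addr0 -[_ *: x]addr0 !innerPl !innerPr.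
rewrite !inner0r !(innerC _ 0) !inner0r !conjC0 !inner_norm normCK.
rewrite [inner y x]innerC conj_Creal ?realX ?normr_real //.
by move: (inner x y) (_^*) (`|x|) (`|y|) => p q r s; ring.
Qed.

Lemma inner_near x (u : nat -> V) (l : V) :
  u @ \oo --> l -> forall e : complex R, 0 < e ->
  \forall n \near \oo, `|inner x l - inner x (u n)| < e.
Proof.
move=> /cvgrPdist_lt ul e e0.
have x1 : 0 < `|x| + 1 by rewrite ltr_wpDl.
apply: filterS (ul (e / (`|x| + 1)) (divr_gt0 e0 x1)) => n.
rewrite ltr_pdivlMr // => lt; rewrite -innerBr.
apply: le_lt_trans (cauchy_schwarz _ _) (le_lt_trans _ lt).
by rewrite mulrC ler_wpM2l // lerDl.
Qed.

End Inner.

(** If [z] were nonzero, the open ball of radius [|z|] around it would meet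
    [D] in some [x], and [|z|^2 = <z, z - x> < |z|^2]. *)
Lemma dense_ortho_eq0 (R : realType) (V : hilbertType R) (D : set V) (z : V) :
  dense D -> (forall x, D x -> inner z x = 0) -> z = 0.
Proof.
move=> Ddense z0; apply/eqP/negPn/negP; rewrite -normr_gt0 => nz.
have [|x [zx Dx]] := Ddense (ball z `|z|) _ (ball_open z _).
  by exists z; exact: ballxx.
move: zx; rewrite -ball_normE /= => lt.
have := cauchy_schwarz z (z - x).
rewrite innerBr (z0 x Dx) subr0 inner_norm ger0_norm ?exprn_ge0 // expr2.
by rewrite ler_pM2l // => /le_lt_trans/(_ lt); rewrite ltxx.
Qed.

(** * Bounds and limits in the complex numbers *)

(** Bounds such as the one on [gamma0] come with a complex constant, about whose
    sign nothing is known; its modulus is a bound too. *)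
Lemma le_mul_norm (C : numDomainType) (a M x : C) :
  0 <= a -> 0 <= x -> a <= M * x -> a <= `|M| * x.
Proof.
move=> a0 x0 le; rewrite -{1}(ger0_norm x0) -normrM.
by apply: (le_trans le); rewrite real_ler_norm // realE (le_trans a0 le).
Qed.

Lemma sqr_norm_subr_le (C : numDomainType) (a b : C) :
  `|a - b| ^+ 2 <= 2 * (`|a| ^+ 2 + `|b| ^+ 2).
Proof.
apply: (@le_trans _ _ ((`|a| + `|b|) ^+ 2)).
  by rewrite ler_sqr ?nnegrE ?addr_ge0 // ler_normB.
rewrite -subr_ge0.
have -> : 2 * (`|a| ^+ 2 + `|b| ^+ 2) - (`|a| + `|b|) ^+ 2 = (`|a| - `|b|) ^+ 2.
  by ring.
by rewrite real_exprn_even_ge0 // rpredB // normr_real.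
Qed.

Section ComplexLimits.
Context {R : realType}.
Local Notation C := (complex R).

(** The order of the complex numbers compares only numbers with equal imaginary
    parts, so a lower bound forces all values of [f] to have the same one, and
    the infimum can be taken over the real parts. *)
Lemma almost_minimizer (T : Type) (D : set T) (f : T -> C) (c e : C) :
  D !=set0 -> (forall x, D x -> c <= f x) -> 0 < e ->
  exists x, D x /\ forall y, D y -> f x <= f y + e.
Proof.
move=> [x0 Dx0] cf; rewrite ltcE /= => /andP[/eqP ie e0].
pose E := [set complex.Re (f x) | x in D].
have hE : has_inf E.
  split; first by exists (complex.Re (f x0)), x0.
  exists (complex.Re c) => _ [x Dx <-].
  by move: (cf _ Dx); rewrite lecE => /andP[].
have [_ [x Dx <-] lt] := inf_adherent e0 hE.
exists x; split=> // y Dy.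
move: (cf _ Dx) (cf _ Dy); rewrite !lecE => /andP[/eqP ix _] /andP[/eqP iy _].
have le : inf E <= complex.Re (f y) by apply: ge_inf; [case: hE|exists y].
case: (f y) (f x) e ie e0 lt ix iy le => [a b] [a' b'] [a'' b''] /=.
move=> -> _ lt -> ->.
rewrite addr0 eqxx /= => le.
by apply/ltW/(lt_le_trans lt); rewrite lerD2r.
Qed.

Lemma near_natSinv_lt (e : C) : 0 < e ->
  \forall n \near \oo, n.+1%:R^-1 < e.
Proof.
move=> e0; have e0' : 0 < complex.Re e by move: e0; rewrite ltcE => /andP[].
have ie : complex.Im e = 0 by move: e0; rewrite ltcE => /andP[/eqP].
have [N _ H] := near_infty_natSinv_lt (PosNum e0').
exists N => // n Nn; have := H n Nn; rewrite /= => lt.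
have -> : e = real_complex R (complex.Re e).
  by case: e ie {e0 e0' H lt} => a b /= ->.
by rewrite -(rmorph_nat (real_complex R)) -fmorphV ltcR.
Qed.

Lemma natSinv_cauchy_cvg (V : completeNormedModType C) (u : nat -> V) :
  (forall n k, `|u n - u k| ^+ 2 <= 2%:R * (n.+1%:R^-1 + k.+1%:R^-1)) ->
  cvg (u @ \oo).
Proof.
move=> uu; apply/cauchy_cvgP/cauchy_ballP => e e0.
have e4 : 0 < e ^+ 2 / 4%:R by rewrite divr_gt0 ?exprn_gt0.
have [N _ HN] := near_natSinv_lt e4.
exists (u @` [set n | (N <= n)%N], u @` [set n | (N <= n)%N]).
  by split; exists N => // n Nn; exists n.
move=> [_ _] [[n Nn <-] [k Nk <-]] /=.
rewrite -ball_normE /= -ltr_sqr ?nnegrE ?normr_ge0 ?ltW //.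
apply: le_lt_trans (uu _ _) _.
have -> : e ^+ 2 = 2 * (e ^+ 2 / 4 + e ^+ 2 / 4) by field.
by rewrite ltr_pM2l // ltrD //; apply: HN.
Qed.

End ComplexLimits.

(** * Graph inner product and Riesz representation *)

Section Graph.
Context {R : realType} {V W : hilbertType R} (T : operator V W).
Local Notation C := (complex R).
Implicit Types (x y z : V) (a : C).

Lemma graph_innerC x y : graph_inner T y x = (graph_inner T x y)^*.
Proof. by rewrite /graph_inner rmorphD /= -!innerC. Qed.

Lemma graph_norm_ge0 x : 0 <= graph_norm T x.
Proof. by rewrite sqrtC_ge0 addr_ge0 ?exprn_ge0. Qed.

Lemma graph_norm_sqr x : graph_norm T x ^+ 2 = graph_inner T x x.
Proof. by rewrite sqrtCK /graph_inner !inner_norm. Qed.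

Lemma graph_inner_ge0 x : 0 <= graph_inner T x x.
Proof. by rewrite -graph_norm_sqr exprn_ge0 ?graph_norm_ge0. Qed.

Lemma norm_le_graph_norm x : `|x| <= graph_norm T x.
Proof.
rewrite -ler_sqr ?nnegrE ?graph_norm_ge0 ?normr_ge0 //.
by rewrite graph_norm_sqr /graph_inner !inner_norm lerDl exprn_ge0.
Qed.

Lemma norm_app_le_graph_norm x : `|T x| <= graph_norm T x.
Proof.
rewrite -ler_sqr ?nnegrE ?graph_norm_ge0 ?normr_ge0 //.
by rewrite graph_norm_sqr /graph_inner !inner_norm lerDr exprn_ge0.
Qed.

Lemma graph_norm_le x : graph_norm T x <= `|x| + `|T x|.
Proof.
rewrite -ler_sqr ?nnegrE ?graph_norm_ge0 ?addr_ge0 //.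
rewrite graph_norm_sqr /graph_inner !inner_norm -subr_ge0.
set p := `|x|; set q := `|T x|.
have -> : (p + q) ^+ 2 - (p ^+ 2 + q ^+ 2) = 2 * (p * q) by ring.
by rewrite !mulr_ge0 // /p /q normr_ge0.
Qed.

Lemma graph_inner_eq0 x : graph_inner T x x = 0 -> x = 0.
Proof.
rewrite -graph_norm_sqr => /eqP; rewrite sqrf_eq0 => /eqP n0.
apply/eqP; rewrite -normr_eq0 eq_le normr_ge0 andbT -n0.
exact: norm_le_graph_norm.
Qed.

Lemma graph_cauchy_schwarz x y :
  `|graph_inner T x y| <= graph_norm T x * graph_norm T y.
Proof.
apply: le_trans (ler_normD _ _) _.
apply: le_trans (lerD (cauchy_schwarz _ _) (cauchy_schwarz _ _)) _.
rewrite -ler_sqr ?nnegrE ?addr_ge0 ?mulr_ge0 ?graph_norm_ge0 //.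
rewrite exprMn !graph_norm_sqr /graph_inner !inner_norm -subr_ge0.
set p := `|x|; set q := `|T x|; set r := `|y|; set s := `|T y|.
have -> : (p ^+ 2 + q ^+ 2) * (r ^+ 2 + s ^+ 2) - (p * r + q * s) ^+ 2
    = (p * s - q * r) ^+ 2 by ring.
by rewrite real_exprn_even_ge0 // rpredB // rpredM // normr_real.
Qed.

(** Sequential closedness of the graph; phrased with sequences, it passes to the
    restriction of an operator without reference to the product topology. *)
Definition seq_closed := forall (u : nat -> V) (x : V) (y : W),
  (forall n, dom T (u n)) -> u @ \oo --> x -> (fun n => T (u n)) @ \oo --> y ->
  dom T x /\ T x = y.

Definition antilinear_on (D : set V) (F : V -> C) := forall a x y,
  D x -> D y -> F (a *: x + y) = a^* * F x + F y.

Context (Tlin : linear_operator T).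

Lemma dom0 : dom T 0.
Proof. by have [[+ _] _] := Tlin; rewrite inE. Qed.

Lemma dom_linear a x y : dom T x -> dom T y -> dom T (a *: x + y).
Proof.
by move=> Dx Dy; have [[_ +] _] := Tlin => /(_ a x y); rewrite !inE; apply.
Qed.

Lemma app_linear a x y : dom T x -> dom T y -> T (a *: x + y) = a *: T x + T y.
Proof. by move=> Dx Dy; have [_ H] := Tlin; apply: H; rewrite inE. Qed.

Lemma domB x y : dom T x -> dom T y -> dom T (x - y).
Proof. by move=> Dx Dy; rewrite addrC -scaleN1r; apply: dom_linear. Qed.

Lemma appB x y : dom T x -> dom T y -> T (x - y) = T x - T y.
Proof.
by move=> Dx Dy; rewrite addrC -scaleN1r app_linear // scaleN1r addrC.
Qed.

Lemma app0 : T 0 = 0.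
Proof. by rewrite -[X in T X](subrr 0) appB ?subrr //; apply: dom0. Qed.

Lemma appN x : dom T x -> T (- x) = - T x.
Proof. by move=> Dx; rewrite -sub0r appB ?app0 ?sub0r //; apply: dom0. Qed.

Lemma domN x : dom T x -> dom T (- x).
Proof. by move=> Dx; rewrite -sub0r; apply: domB => //; apply: dom0. Qed.

Lemma graph_innerPr z a x y : dom T x -> dom T y ->
  graph_inner T z (a *: x + y) = a * graph_inner T z x + graph_inner T z y.
Proof.
by move=> Dx Dy; rewrite /graph_inner app_linear // !innerPr mulrDr addrACA.
Qed.

Lemma graph_innerPl z a x y : dom T x -> dom T y ->
  graph_inner T (a *: x + y) z = a^* * graph_inner T x z + graph_inner T y z.
Proof.
by move=> Dx Dy; rewrite graph_innerC graph_innerPr // rmorphD rmorphM /=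
  -!graph_innerC.
Qed.

Lemma graph_innerBr z x y : dom T x -> dom T y ->
  graph_inner T z (x - y) = graph_inner T z x - graph_inner T z y.
Proof.
by move=> Dx Dy; rewrite addrC -scaleN1r graph_innerPr // mulN1r addrC.
Qed.

Lemma graph_innerBl z x y : dom T x -> dom T y ->
  graph_inner T (x - y) z = graph_inner T x z - graph_inner T y z.
Proof.
move=> Dx Dy.
by rewrite graph_innerC graph_innerBr // rmorphB /= -!graph_innerC.
Qed.

(** [J] is the Dirichlet functional [|z|^2 - 2 Re F z], and [c] measures by
    how much [x] fails to represent [F] at [y]. *)
Lemma dirichlet_step (F : V -> C) x y (t : C) : antilinear_on (dom T) F ->
  dom T x -> dom T y ->
  let J z := graph_inner T z z - (F z + (F z)^*) in
  let c := graph_inner T y x - F y in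
  J (t *: y + x) = J x + `|t| ^+ 2 * graph_inner T y y + (t^* * c + t * c^*).
Proof.
move=> Flin Dx Dy J c; rewrite /J /c graph_innerPr //.
rewrite !graph_innerPl // Flin // normCK (graph_innerC y x).
move: (graph_inner T y x) (graph_inner T y y) (graph_inner T x x) => g p q.
rewrite !(rmorphD, rmorphM, rmorphN) /= conjCK.
move: (g^*) (t^*) ((F y)^*) ((F x)^*) => *; ring.
Qed.

(** [J] varies along [y] as the quadratic polynomial of [dirichlet_step],
    which stays above [- e] only if its discriminant is bounded. A factor
    [graph_inner T y y] on the right, rather than a bound that is uniform for
    [y] in the unit ball, makes the estimate applicable with [y] a difference
    of two almost minimizers. *)
Lemma almost_minimizer_residual (F : V -> C) x (e : C) :
  antilinear_on (dom T) F -> dom T x -> 0 < e ->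
  let J z := graph_inner T z z - (F z + (F z)^*) in
  (forall z, dom T z -> J x <= J z + e) ->
  forall y, dom T y ->
    `|graph_inner T y x - F y| ^+ 2 <= graph_inner T y y * e.
Proof.
move=> Flin Dx e0 J minx y Dy; set c := _ - F y.
have [->|c0] := eqVneq c 0.
  by rewrite normr0 expr0n mulr_ge0 ?graph_inner_ge0 ?ltW.
have nc : 0 < `|c| ^+ 2 by rewrite exprn_gt0 ?normr_gt0.
(* The step [- s c] gives [J] the increment [s^2 |c|^2 |y|^2 - 2 s |c|^2]; with
   [s = e / |c|^2] the linear term is [- 2 e]. *)
pose s := e / `|c| ^+ 2; have s0 : 0 < s by rewrite divr_gt0.
have := minx _ (dom_linear (- s * c) Dy Dx).
rewrite /J dirichlet_step // -/c -/(J x) -subr_ge0.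
rewrite rmorphM rmorphN /= (conj_Creal (gtr0_real s0)).
rewrite normrM normrN (gtr0_norm s0).
have -> : - s * c^* * c + - s * c * c^* = - 2 * e.
  rewrite -[e](divfK (lt0r_neq0 nc)) -/s normCK.
  by move: (c^*) => ?; ring.
have -> : (s * `|c|) ^+ 2 * graph_inner T y y = s * (e * graph_inner T y y).
  rewrite -[e in RHS](divfK (lt0r_neq0 nc)) -/s; ring.
have -> (j : C) : j + s * (e * graph_inner T y y) + - 2 * e + e - j
   = s * (graph_inner T y y * e - `|c| ^+ 2).
  have {2 3}-> : e = s * `|c| ^+ 2 by rewrite divfK ?lt0r_neq0.
  by ring.
by rewrite pmulr_rge0 // subr_ge0.
Qed.

(** Almost minimizers [u n] of the Dirichlet functional form a Cauchy sequence
    for the graph norm; closedness of [T] puts the limit into the domain, and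
    the residuals of [u n], which tend to zero, show that the limit represents
    [F]. *)
Lemma riesz (F : V -> C) (M : C) : seq_closed -> antilinear_on (dom T) F ->
  (forall x, dom T x -> `|F x| <= M * graph_norm T x) ->
  exists r, dom T r /\ forall x, dom T x -> graph_inner T x r = F x.
Proof.
move=> Tcl Flin Fbd.
pose J z := graph_inner T z z - (F z + (F z)^*).
have Jbd x : dom T x -> - `|M| ^+ 2 <= J x.
  move=> Dx; have le1 : F x + (F x)^* <= 2 * (`|M| * graph_norm T x).
    have -> : F x + (F x)^* = 2 * 'Re (F x) by rewrite ReE; field.
    rewrite ler_pM2l //; apply: le_trans (leif_Re_Creal _) _.
    by apply: le_mul_norm (Fbd x Dx); rewrite ?graph_norm_ge0.
  rewrite /J lerBrDr -graph_norm_sqr.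
  rewrite (le_trans (lerD (lexx _) le1)) // -subr_ge0.
  have -> : graph_norm T x ^+ 2 - (- `|M| ^+ 2 + 2 * (`|M| * graph_norm T x))
     = (graph_norm T x - `|M|) ^+ 2 by ring.
  by rewrite real_exprn_even_ge0 // rpredB // ger0_real ?graph_norm_ge0.
have d0 : dom T !=set0 by exists 0; apply: dom0.
have e0 n : (0 : C) < n.+1%:R^-1 by rewrite invr_gt0 ltr0n.
have /choice [u Hu] : forall n, exists x, dom T x /\
    forall y, dom T y -> J x <= J y + n.+1%:R^-1.
  by move=> n; apply: almost_minimizer d0 Jbd (e0 n).
have Du n : dom T (u n) by have [] := Hu n.
have res n y : dom T y -> `|graph_inner T y (u n) - F y| ^+ 2
    <= graph_inner T y y * n.+1%:R^-1.
  by apply: almost_minimizer_residual => //; have [] := Hu n.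
(* Both residuals at [y = u n - u k] are small compared with [|y|], and their
   difference is [|y|^2]. *)
have uu n k : graph_inner T (u n - u k) (u n - u k)
    <= 2%:R * (n.+1%:R^-1 + k.+1%:R^-1).
  have Dy := domB (Du n) (Du k); set y := u n - u k in Dy *.
  have := graph_inner_ge0 y; rewrite le_eqVlt => /orP[/eqP <-|N0].
    by rewrite mulr_ge0 ?addr_ge0 // ltW.
  rewrite -(ler_pM2l N0).
  rewrite -expr2.
  have {1}-> : graph_inner T y y = `|(graph_inner T y (u n) - F y)
      - (graph_inner T y (u k) - F y)|.
    rewrite -[LHS]ger0_norm ?graph_inner_ge0 // {2}/y graph_innerBr //.
    by congr `|_|; ring.
  apply: le_trans (sqr_norm_subr_le _ _) _.
  have -> : graph_inner T y y * (2 * (n.+1%:R^-1 + k.+1%:R^-1))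
    = 2 * (graph_inner T y y * n.+1%:R^-1 + graph_inner T y y * k.+1%:R^-1).
    by ring.
  by rewrite ler_pM2l // lerD //; apply: res.
have un n k : `|u n - u k| ^+ 2 <= 2%:R * (n.+1%:R^-1 + k.+1%:R^-1).
  apply: le_trans (uu n k).
  rewrite -graph_norm_sqr ler_sqr ?nnegrE ?graph_norm_ge0 //.
  exact: norm_le_graph_norm.
have Tun n k : `|T (u n) - T (u k)| ^+ 2 <= 2%:R * (n.+1%:R^-1 + k.+1%:R^-1).
  apply: le_trans (uu n k).
  rewrite -graph_norm_sqr ler_sqr ?nnegrE ?graph_norm_ge0 //.
  by rewrite -appB //; exact: norm_app_le_graph_norm.
have ur := natSinv_cauchy_cvg un; have Tur := natSinv_cauchy_cvg Tun.
have [Dr Tr] := Tcl _ _ _ Du ur Tur.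
exists (lim (u @ \oo)); split=> // x Dx; move: ur Tur.
set r := lim _ in Dr Tr *; rewrite -Tr => ur Tur.
apply/eqP; rewrite -subr_eq0; apply/negPn/negP; rewrite -normr_gt0 => gap.
have e3 : 0 < `|graph_inner T x r - F x| / 3%:R by rewrite divr_gt0.
have e2 : 0 <
    (`|graph_inner T x r - F x| / 3%:R) ^+ 2 / (graph_inner T x x + 1).
  by rewrite divr_gt0 ?exprn_gt0 // ltr_wpDl ?graph_inner_ge0.
have [n] := @filter_ex _ \oo _ _ (filterI (filterI (inner_near x ur e3)
  (inner_near (T x) Tur e3)) (near_natSinv_lt e2)).
move=> [[l1 l2] l3].
have l4 : `|graph_inner T x (u n) - F x| < `|graph_inner T x r - F x| / 3%:R.
  rewrite -ltr_sqr ?nnegrE // ?ltW //; apply: le_lt_trans (res n x Dx) _.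
  move: l3; rewrite ltr_pdivlMr ?ltr_wpDl ?graph_inner_ge0 // => l3.
  apply: le_lt_trans l3; rewrite mulrC ler_wpM2l ?(ltW (e0 n)) //.
  by rewrite lerDl.
suff : `|graph_inner T x r - F x| < `|graph_inner T x r - F x| by rewrite ltxx.
have {1}-> : graph_inner T x r - F x = (inner x r - inner x (u n))
    + (inner (T x) (T r) - inner (T x) (T (u n)))
    + (graph_inner T x (u n) - F x).
  by rewrite /graph_inner; ring.
have -> : `|graph_inner T x r - F x| = `|graph_inner T x r - F x| / 3
   + `|graph_inner T x r - F x| / 3 + `|graph_inner T x r - F x| / 3 by field.
apply: le_lt_trans (ler_normD _ _) _; apply: ltrD => //.
by apply: le_lt_trans (ler_normD _ _) _; apply: ltrD => //; rewrite Tr.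
Qed.

End Graph.
Lemma closed_operator_seq_closed (R : realType) (V W : hilbertType R)
  (T : operator V W) : closed_operator T -> seq_closed T.
Proof.
move=> Tcl u x y Du ux Tuy.
suff [] : graph T (x, y) by move=> /= Dx ->.
apply: (closed_cvg (graph T) Tcl _ (x, y) (cvg_pair ux Tuy)).
by exists 0%N => // n _; split=> //; exact: Du.
Qed.

(** * The orthogonal decomposition of the domain of the exterior derivative *)

Section Triple.
Context {R : realType} {H0 H1 G : hilbertType R}.
Local Notation C := (complex R).
Context (d : operator H0 H1) (gamma0 : H0 -> G).
Context (triple : boundary_triple d gamma0).
Let d_lin := ext_deriv_linear triple.
Local Notation K := (ker_gamma0 d gamma0).
Local Notation d0 := (Defs.restrict d K).
Local Notation div := (divergence d gamma0).
Local Notation N0 := (N0 d gamma0).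
Local Notation N1 := (N1 d gamma0).
Local Notation Ghalf := (Ghalf d gamma0).
Local Notation hat := (hat_gamma0_inv d gamma0).

Lemma gamma0_linearP a x y : dom d x -> dom d y ->
  gamma0 (a *: x + y) = a *: gamma0 x + gamma0 y.
Proof. by move=> Dx Dy; apply: (gamma0_linear triple); rewrite inE. Qed.

Lemma gamma0B x y : dom d x -> dom d y -> gamma0 (x - y) = gamma0 x - gamma0 y.
Proof.
by move=> Dx Dy; rewrite addrC -scaleN1r gamma0_linearP // scaleN1r addrC.
Qed.

Lemma gamma0_0 : gamma0 0 = 0.
Proof.
by rewrite -[X in gamma0 X](subrr 0) gamma0B ?subrr //; apply: dom0.
Qed.

Lemma restrict_ker_linear : linear_operator d0.
Proof.
split; first split.
- by rewrite inE; split; [|split=> //; last exact: gamma0_0]; exact: dom0 d_lin.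
- move=> a x y; rewrite !inE => -[_ [Dx x0]] [_ [Dy y0]].
  have Dxy : dom d (a *: x + y) by apply: dom_linear.
  by split=> //; split=> //; rewrite gamma0_linearP // x0 y0 scaler0 addr0.
move=> a x y; rewrite !inE => -[Dx _] [Dy _]; exact: (app_linear d_lin).
Qed.

(** [gamma0 x = gamma0 (x - u n)] for [u n] in the kernel, and the right side
    tends to zero because [gamma0] is bounded in the graph norm. *)
Lemma restrict_ker_seq_closed : seq_closed d0.
Proof.
move=> u x y Ku ux duy.
have Du n : dom d (u n) by have [] := Ku n.
have [Dx dx] := closed_operator_seq_closed (ext_deriv_closed triple) Du ux duy.
split=> //; split=> //; split=> //.
have [M HM] := gamma0_bounded triple.
apply/eqP/negPn/negP; rewrite -normr_gt0 => g0.
have M1 : 0 < `|M| + 1 by rewrite ltr_wpDl.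
pose e := `|gamma0 x| / (`|M| + 1) / 2.
have e0 : 0 < e by rewrite !divr_gt0.
have [n [l1 l2]] := @filter_ex _ \oo _ _ (filterI
  ((cvgrPdist_lt _ _).1 ux e e0) ((cvgrPdist_lt _ _).1 duy e e0)).
have Dxu : dom d (x - u n) by apply: domB.
have gxu : gamma0 (x - u n) = gamma0 x.
  by have [_ [_ un0]] := Ku n; rewrite gamma0B // un0 subr0.
have small : graph_norm d (x - u n) < e + e.
  apply: le_lt_trans (graph_norm_le _ _) _.
  by rewrite ltrD // (appB d_lin) // dx.
have : `|gamma0 x| <= (`|M| + 1) * graph_norm d (x - u n).
  have le := HM _ Dxu; rewrite gxu in le.
  apply: le_trans (le_mul_norm _ _ le) _; rewrite ?graph_norm_ge0 //.
  by rewrite ler_wpM2r ?graph_norm_ge0 // lerDl.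
have <- : (`|M| + 1) * (e + e) = `|gamma0 x|.
  by rewrite /e; field; rewrite gt_eqF.
by rewrite ler_pM2l // => /le_lt_trans/(_ small); rewrite ltxx.
Qed.

Lemma divergenceP y k : dom div y -> K k -> inner y (d k) = inner (div y) k.
Proof. by move=> Dy Kk; apply: (xgetPex 0 Dy); split=> //; case: Kk. Qed.

(** Density of [K] makes the adjoint single-valued. *)
Lemma divergence_unique y z : (forall k, K k -> inner y (d k) = inner z k) ->
  dom div y /\ div y = z.
Proof.
move=> yz; have Dy : dom div y by exists z => k [_]; exact: yz.
split=> //; apply/eqP; rewrite -subr_eq0; apply/eqP.
apply: (dense_ortho_eq0 (gamma0_dense_kernel triple)) => k Kk.
by rewrite innerBl -yz // divergenceP // subrr.
Qed.

Lemma divergenceB x y : dom div x -> dom div y -> div (x - y) = div x - div y.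
Proof.
move=> Dx Dy; apply: (divergence_unique _).2 => k Kk.
by rewrite !innerBl !divergenceP.
Qed.

Lemma N0_ortho h k : N0 h -> K k -> graph_inner d h k = 0.
Proof.
move=> [_ Dd /eqP]; rewrite addr_eq0 => /eqP e Kk.
by rewrite /graph_inner divergenceP // e innerNl subrr.
Qed.

Lemma ortho_N0 h : dom d h -> (forall k, K k -> graph_inner d h k = 0) -> N0 h.
Proof.
move=> Dh hK; have [] := @divergence_unique (d h) (- h).
  by move=> k /hK/eqP; rewrite innerNl addr_eq0 => /eqP ->; rewrite opprK.
by move=> Dd e; split=> //; rewrite e addNr.
Qed.

Lemma N0_dom h : N0 h -> dom d h. Proof. by case. Qed.

Lemma N0_linear a x y : N0 x -> N0 y -> N0 (a *: x + y).
Proof.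
move=> Nx Ny; have [Dx Dy] := (N0_dom Nx, N0_dom Ny).
apply: ortho_N0 => [|k Kk]; first exact: dom_linear.
by rewrite (graph_innerPl d_lin) // !N0_ortho // mulr0 addr0.
Qed.

Lemma N0_cap_ker h : N0 h -> gamma0 h = 0 -> h = 0.
Proof.
move=> Nh h0; apply: (@graph_inner_eq0 _ _ _ d).
by apply: N0_ortho => //; split=> //; apply: N0_dom.
Qed.

(** [f - u] represents on [K] the functional [k |-> <k, f>] of the graph inner
    product: it is the orthogonal projection of [f] onto [K], which is
    complete by [restrict_ker_seq_closed]. *)
Lemma N0_decomposition f : dom d f -> exists u, N0 u /\ K (f - u).
Proof.
move=> Df.
have [||k0 [[Dk0 [_ k00]] Hk]] :=
  @riesz _ _ _ _ restrict_ker_linear (fun k => graph_inner d k f)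
    (graph_norm d f) restrict_ker_seq_closed.
- by move=> a x y [Dx _] [Dy _]; apply: graph_innerPl.
- by move=> x [Dx _]; rewrite mulrC; apply: graph_cauchy_schwarz.
have Du := domB d_lin Df Dk0.
exists (f - k0); split; last first.
  by split; [exact: domB|rewrite opprB addrC subrK].
apply: ortho_N0 => // k Kk; rewrite graph_innerC.
rewrite (graph_innerBr d_lin) // -Hk; last by split=> //; case: Kk.
by rewrite subrr conjC0.
Qed.

Lemma hat_gamma0_invP phi : Ghalf phi -> N0 (hat phi) /\ gamma0 (hat phi) = phi.
Proof.
move=> [f Df <-]; apply: (@xgetPex _ 0 [set h | N0 h /\ gamma0 h = gamma0 f]).
have [u [Nu [_ fu]]] := N0_decomposition Df; exists u; split=> //.
apply/eqP; rewrite eq_sym -subr_eq0 -gamma0B ?fu //; exact: N0_dom.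
Qed.

Lemma Ghalf_gamma0 f : dom d f -> Ghalf (gamma0 f).
Proof. by exists f. Qed.

Lemma hat_gamma0_invK h : N0 h -> hat (gamma0 h) = h.
Proof.
move=> Nh; have Dh := N0_dom Nh.
have [Nh' e] := hat_gamma0_invP (Ghalf_gamma0 Dh).
apply/eqP; rewrite -subr_eq0; apply/eqP; apply: N0_cap_ker.
  by rewrite addrC -scaleN1r; apply: N0_linear.
by rewrite gamma0B ?e ?subrr //; apply: N0_dom.
Qed.

Lemma hat_gamma0_inv_linear a phi psi : Ghalf phi -> Ghalf psi ->
  hat (a *: phi + psi) = a *: hat phi + hat psi.
Proof.
move=> /hat_gamma0_invP [Nx ex] /hat_gamma0_invP [Ny ey].
rewrite -{1}ex -{1}ey -gamma0_linearP; try exact: N0_dom.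
by rewrite hat_gamma0_invK //; apply: N0_linear.
Qed.

(** The preimage of [gamma0 f] in [N0] differs from [f] by an element of [K],
    which is orthogonal to [h]. *)
Lemma Ghalf_inner_gamma0 f h : dom d f -> N0 h ->
  Ghalf_inner d gamma0 (gamma0 f) (gamma0 h) = graph_inner d f h.
Proof.
move=> Df Nh; have [Nu e] := hat_gamma0_invP (Ghalf_gamma0 Df).
rewrite /Ghalf_inner (hat_gamma0_invK Nh); set u := hat _ in Nu e *.
have Du := N0_dom Nu; apply/eqP; rewrite eq_sym -subr_eq0.
rewrite -(graph_innerBl d_lin) // graph_innerC N0_ortho ?conjC0 //.
by split; [exact: domB|rewrite gamma0B // e subrr].
Qed.

(** The preimage [u] of [gamma0 f] in [N0] satisfies [<f, u> = <u, u>], so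
    Cauchy-Schwarz bounds its norm by that of [f]. *)
Lemma Ghalf_norm_gamma0_le f : dom d f ->
  Ghalf_norm d gamma0 (gamma0 f) <= graph_norm d f.
Proof.
move=> Df; have [Nu e] := hat_gamma0_invP (Ghalf_gamma0 Df).
rewrite /Ghalf_norm; have := Ghalf_inner_gamma0 Df Nu; rewrite e.
rewrite /Ghalf_inner; set u := hat _ => uu.
have := graph_cauchy_schwarz d f u; rewrite -uu -graph_norm_sqr.
rewrite ger0_norm ?exprn_ge0 ?graph_norm_ge0 // expr2.
have := graph_norm_ge0 d u; rewrite le_eqVlt => /orP[/eqP <-|u0].
  by rewrite graph_norm_ge0.
by rewrite ler_pM2r.
Qed.

Lemma riesz_N0 (F : H0 -> C) (M : C) : antilinear_on (dom d) F ->
  (forall f, dom d f -> `|F f| <= M * graph_norm d f) ->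
  (forall k, K k -> F k = 0) ->
  exists h, N0 h /\ forall f, dom d f -> graph_inner d f h = F f.
Proof.
move=> Flin Fbd FK.
have [h [Dh Hh]] := riesz d_lin
  (closed_operator_seq_closed (ext_deriv_closed triple)) Flin Fbd.
exists h; split=> //; apply: ortho_N0 => // k Kk.
by rewrite graph_innerC Hh ?FK ?conjC0 //; case: Kk.
Qed.

(** * The boundary map of order one *)

(** The functional on the right vanishes on [K] because the divergence is the
    adjoint of [d] restricted to [K]. *)
Lemma green_representative g : dom div g -> exists h, N0 h /\
  forall f, dom d f -> graph_inner d f h = inner (d f) g - inner f (div g).
Proof.
move=> Dg; apply: (@riesz_N0 _ (`|g| + `|div g|)).
- move=> a x y Dx Dy; rewrite (app_linear d_lin) // !innerPl.
  by move: (a^*) => b; ring.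
- move=> f Df; apply: le_trans (ler_normB _ _) _.
  apply: le_trans (lerD (cauchy_schwarz _ _) (cauchy_schwarz _ _)) _.
  rewrite mulrDl ![_ * graph_norm _ _]mulrC lerD // ler_wpM2r //.
    exact: norm_app_le_graph_norm.
  exact: norm_le_graph_norm.
- move=> k Kk; rewrite innerC divergenceP // -innerC subrr //.
Qed.

Lemma divergence_d h : N0 h -> div (d h) = - h.
Proof. by move=> [_ _ e]; apply/eqP; rewrite -addr_eq0 e. Qed.

Lemma N0_N1 h : N0 h -> N1 (d h).
Proof.
move=> Nh; have e := divergence_d Nh; have [Dh Dd _] := Nh.
by split=> //; rewrite e ?(appN d_lin) ?addNr //; apply: domN.
Qed.

Lemma N1_N0 q : N1 q -> N0 (- div q) /\ d (- div q) = q.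
Proof.
move=> [Dq Dd e].
have e' : d (- div q) = q.
  by rewrite (appN d_lin) //; apply/eqP; rewrite eqr_oppLR -addr_eq0 e.
split=> //; split; rewrite ?e' ?subrr //; exact: domN.
Qed.

Lemma divergence_graph_inner g h w : dom div g -> N0 h -> N0 w ->
  graph_inner div (d w) (g - d h)
    = inner (d w) g - inner w (div g) - graph_inner d w h.
Proof.
move=> Dg Nh Nw; have [_ Ddh _] := Nh.
rewrite /graph_inner divergenceB // !divergence_d // opprK.
by rewrite innerNl innerBr [inner w (_ + _)]innerDr; ring.
Qed.

(** [N1] is the image of [N0] under [d], and by [divergence_graph_inner] the
    projection of [g] onto it is [d h], [h] being that of [green_representative];
    this gives both the existence of the projection and its value. *)
Lemma gamma1_representative g : dom div g -> exists h, [/\ N0 h,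
  gamma1 d gamma0 g = gamma0 h &
  forall f, dom d f -> graph_inner d f h = inner (d f) g - inner f (div g)].
Proof.
move=> Dg; have [h [Nh Hh]] := green_representative Dg.
have [|Np Hp] := @xgetPex _ 0 [set p | N1 p /\
    forall q, N1 q -> graph_inner div q (g - p) = 0].
  exists (d h); split=> [|q Nq]; first exact: N0_N1.
  have [Nw <-] := N1_N0 Nq.
  by rewrite divergence_graph_inner // Hh ?subrr //; apply: N0_dom.
rewrite /gamma1 /graph_proj; set p := xget _ _ in Np Hp *.
have [Nh' ep] := N1_N0 Np; set h' := - div p in Nh' ep.
have hh' : h = h'.
  have Nw : N0 (h - h') by rewrite addrC -scaleN1r; apply: N0_linear.
  apply/eqP; rewrite -subr_eq0; apply/eqP.
  apply: (@graph_inner_eq0 _ _ _ d).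
  rewrite (graph_innerBr d_lin); try exact: N0_dom.
  rewrite Hh; last exact: N0_dom.
  by rewrite -divergence_graph_inner // ep; apply: Hp; apply: N0_N1.
exists h; split=> //.
rewrite hh' /h' -[- div p]sub0r gamma0B ?gamma0_0 ?sub0r //.
  exact: dom0.
by case: Np.
Qed.

(** * The extension of [Lambda] is the Riesz map of [G^{1/2}] *)

Lemma gamma0_adjP eta : dom d (gamma0_adj d gamma0 eta) /\
  forall f, dom d f ->
    graph_inner d (gamma0_adj d gamma0 eta) f = inner eta (gamma0 f).
Proof.
apply: (@xgetPex _ 0 [set h | dom d h /\ forall f, dom d f ->
  graph_inner d h f = inner eta (gamma0 f)]).
have [M HM] := gamma0_bounded triple.
have [|||h [Nh Hh]] := @riesz_N0 (fun f => inner (gamma0 f) eta) (M * `|eta|).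
- by move=> a x y Dx Dy; rewrite gamma0_linearP // innerPl.
- move=> f Df; apply: le_trans (cauchy_schwarz _ _) _.
  by rewrite mulrAC ler_wpM2r // HM.
- by move=> k [_ ->]; rewrite innerC inner0r conjC0.
exists h; split=> [|f Df]; first exact: N0_dom.
by rewrite graph_innerC Hh // -innerC.
Qed.

Lemma gamma0_adj_N0 eta : N0 (gamma0_adj d gamma0 eta).
Proof.
have [Dh Hh] := gamma0_adjP eta.
by apply: ortho_N0 => // k [Dk k0]; rewrite Hh // k0 inner0r.
Qed.

(** [Lambda psi] is some [eta] with [gamma0 (gamma0^* eta) = psi]; as
    [gamma0^* eta] lies in [N0], [<gamma0 f, eta> = <f, gamma0^* eta>] is the
    [G^{1/2}] inner product. *)
Lemma inner_Lambda psi phi : dom (Lambda d gamma0) psi -> Ghalf phi ->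
  inner phi (Lambda d gamma0 psi) = Ghalf_inner d gamma0 phi psi.
Proof.
move=> [eta0 _ e0] [f Df <-].
have : gamma0 (gamma0_adj d gamma0 (Lambda d gamma0 psi)) = psi.
  apply: (@xgetPex _ 0 [set eta | gamma0 (gamma0_adj d gamma0 eta) = psi]).
  by exists eta0.
move: (Lambda d gamma0 psi) => eta <-.
rewrite Ghalf_inner_gamma0 //; last exact: gamma0_adj_N0.
by rewrite graph_innerC (gamma0_adjP eta).2 // -innerC.
Qed.

Lemma Ghalf_inner_cauchy_schwarz phi psi :
  `|Ghalf_inner d gamma0 phi psi|
    <= Ghalf_norm d gamma0 phi * Ghalf_norm d gamma0 psi.
Proof. exact: graph_cauchy_schwarz. Qed.

Lemma Ghalf_inner_bounded_extension :
  bounded_extension d gamma0 (fun psi phi => Ghalf_inner d gamma0 phi psi).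
Proof.
have Dhat phi : Ghalf phi -> dom d (hat phi).
  by move=> /hat_gamma0_invP [/N0_dom].
split.
- move=> psi Gpsi; split.
    move=> a x y; rewrite !inE => Gx Gy.
    rewrite /Ghalf_inner hat_gamma0_inv_linear //.
    by rewrite (graph_innerPl d_lin) //; apply: Dhat.
  exists (Ghalf_norm d gamma0 psi) => phi _.
  by rewrite mulrC; apply: Ghalf_inner_cauchy_schwarz.
- move=> a x y phi; rewrite !inE => Gx Gy Gphi.
  rewrite /pairing /Ghalf_inner hat_gamma0_inv_linear //.
  by rewrite (graph_innerPr d_lin) //; apply: Dhat.
- exists 1 => psi _ phi _; rewrite mul1r mulrC.
  exact: Ghalf_inner_cauchy_schwarz.
- by move=> psi phi Dpsi Gphi; rewrite inner_Lambda.
Qed.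

(** Density of [dom Lambda] in [G^{1/2}] enters as the injectivity of [gamma0]
    on [N0]: boundedness of [L] makes [psi |-> (phi, L psi)] the inner product
    with some [r] in [N0], and [r] is determined by its inner products with
    the range of the adjoint of [gamma0], whose image under [gamma0] is
    [dom Lambda], where [L] is prescribed. *)
Lemma bounded_extensionE L psi phi : bounded_extension d gamma0 L ->
  Ghalf psi -> Ghalf phi -> pairing phi (L psi) = Ghalf_inner d gamma0 phi psi.
Proof.
move=> [_ Llin [M HM] LLambda] /hat_gamma0_invP [Nf <-] Gphi.
set f := hat psi in Nf *; have Df := N0_dom Nf.
have [Nv ev] := hat_gamma0_invP Gphi; set v := hat phi in Nv ev.
have lenM x : 0 <= Ghalf_norm d gamma0 x by apply: graph_norm_ge0.
have [|||r [Nr Hr]] := @riesz_N0 (fun f => (L (gamma0 f) phi)^*)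
    (`|M| * Ghalf_norm d gamma0 phi).
- move=> a x y Dx Dy; rewrite gamma0_linearP //.
  have := Llin a (gamma0 x) (gamma0 y) phi; rewrite /pairing => ->;
    try by rewrite inE //; apply: Ghalf_gamma0.
  by rewrite rmorphD rmorphM.
- move=> g Dg; rewrite norm_conjC.
  have le := HM _ (Ghalf_gamma0 Dg) _ Gphi; rewrite /pairing in le.
  rewrite -mulrA in le.
  apply: le_trans (le_mul_norm _ _ le) _; rewrite ?mulr_ge0 //.
  by rewrite -mulrA ler_wpM2l // mulrC ler_wpM2l // Ghalf_norm_gamma0_le.
- move=> k [Dk k0].
  have Gk : Ghalf 0 by rewrite -gamma0_0; apply: Ghalf_gamma0; apply: dom0.
  have := Llin (-1) 0 0 phi; rewrite /pairing scaler0 addr0 mulN1r addNr k0.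
  by move=> ->; rewrite ?conjC0 ?inE.
suff vr : v = r.
  rewrite -[in RHS]ev Ghalf_inner_gamma0 //; last exact: N0_dom.
  by rewrite /pairing -[LHS]conjCK -Hr // -vr -graph_innerC.
apply/eqP; rewrite -subr_eq0; apply/eqP.
have Nw : N0 (v - r) by rewrite addrC -scaleN1r; apply: N0_linear.
have [Dv Dr] := (N0_dom Nv, N0_dom Nr).
apply: N0_cap_ker => //.
set eta := gamma0 (v - r).
(* This inner product is also [<eta, gamma0 (v - r)> = |eta|^2]. *)
have : graph_inner d (gamma0_adj d gamma0 eta) (v - r) = 0.
  have Na := gamma0_adj_N0 eta; have Da := N0_dom Na.
  rewrite (graph_innerBr d_lin) // Hr //.
  have DL : dom (Lambda d gamma0) (gamma0 (gamma0_adj d gamma0 eta)).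
    by exists eta.
  have := LLambda _ _ DL Gphi; rewrite /pairing => ->.
  rewrite inner_Lambda // -ev Ghalf_inner_gamma0 //.
  by rewrite -graph_innerC subrr.
rewrite (gamma0_adjP eta).2; last exact: N0_dom.
rewrite -/eta inner_norm => /eqP.
by rewrite sqrf_eq0 normr_eq0 => /eqP.
Qed.

Lemma Lambda_extE psi phi : Ghalf psi -> Ghalf phi ->
  pairing phi (Lambda_ext d gamma0 psi) = Ghalf_inner d gamma0 phi psi.
Proof.
apply: bounded_extensionE.
apply: (@xgetPex _ _ [set L | bounded_extension d gamma0 L]).
by eexists; exact: Ghalf_inner_bounded_extension.
Qed.

End Triple.

(** * Green's formula *)

Theorem lemma2p14 (R : realType) (H0 H1 G : hilbertType R)
  (d : operator H0 H1) (gamma0 : H0 -> G)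
  (triple : boundary_triple d gamma0)
  (f0 : H0) (g1 : H1)
  (hf0 : dom d f0) (hg1 : dom (divergence d gamma0) g1) :
  inner (d f0) g1 - inner f0 (divergence d gamma0 g1)
    = Ghalf_inner d gamma0 (gamma0 f0) (gamma1 d gamma0 g1)
  /\
  Ghalf_inner d gamma0 (gamma0 f0) (gamma1 d gamma0 g1)
    = pairing (gamma0 f0) (tilde_gamma1 d gamma0 g1).
Proof.
have [h [Nh e Hh]] := gamma1_representative triple hg1.
split; first by rewrite e (Ghalf_inner_gamma0 triple) // Hh.
apply/esym/(Lambda_extE triple); last exact: Ghalf_gamma0.
by rewrite e; apply: Ghalf_gamma0; apply: N0_dom Nh.
Qed.
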